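(* (i) There is an instance $(G,c,r,m)$ for which the unrestricted MV-mTSP$_+$ with arbitrary tours (P1) and the unrestricted MV-mTSP$_0$ with arbitrary tours (P3) have optimal solutions of different cost: $\mathsf{OPT}_{\mathrm{P1}}\neq\mathsf{OPT}_{\mathrm{P3}}$. (ii) There is an instance $(G,c,r,m)$ for which the unrestricted MV-mTSP$_+$ with disjoint tours (P2) and the unrestricted MV-mTSP$_0$ with disjoint tours (P4) have optimal solutions of different cost: $\mathsf{OPT}_{\mathrm{P2}}\neq\mathsf{OPT}_{\mathrm{P4}}$.
   Context: Instance: a finite vertex set $V$; $G=(V,E)$ is the complete undirected graph on $V$, including a self-loop $vv$ at each $v$; symmetric costs $c(uv)\geq 0$ (self-loop costs $c(vv)$ are not assumed to be zero) that are metric: $c(uw)\leq c(uv)+c(vw)$ for all $u,v,w\in V$, and $c(vv)\leq 2\min_{u\in V\setminus\{v\}}c(uv)$ for all $v\in V$; requests $r:V\to\mathbb{Z}_{\geq 1}$; an integer $m\geq 1$ (number of agents). A multigraph is a multiset $X$ of edges (self-loops allowed) on $V$; $\operatorname{cost}(X)=\sum_{uv} x(uv)c(uv)$, where $x(uv)$ is the multiplicity of $uv$ in $X$. The degree $\dot\delta_X(v)$ counts each copy of the self-loop $vv$ twice. An MVTSP tour is a connected multigraph in which every degree is even; a multigraph with even degrees visits $v$ exactly $\dot\delta_X(v)/2$ times. A tour is non-empty if it has at least one edge. Each problem asks for a minimum-cost multigraph $X$ visiting each $v\in V$ exactly $r(v)$ times, such that: (P1) the edge multiset of $X$ can be partitioned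 into exactly $m$ non-empty, not necessarily vertex-disjoint MVTSP tours; (P2) $X$ has exactly $m$ connected components, each a non-empty MVTSP tour; (P3) the edge multiset of $X$ can be partitioned into at most $m$ not necessarily vertex-disjoint MVTSP tours; (P4) $X$ has at most $m$ connected components, each an MVTSP tour. $\mathsf{OPT}_{\mathrm{P}i}$ denotes the cost of an optimal solution to P$i$ (the instances asserted to exist are ones on which both problems are feasible). *)

(* Defs.v *)
From HB Require Import structures.
From mathcomp Require Import all_boot all_order all_algebra.

Set Implicit Arguments.
Unset Strict Implicit.
Unset Printing Implicit Defensive.

Import Order.TTheory GRing.Theory Num.Theory.

(* Edges of the complete undirected graph on V with a self-loop at every
   vertex: an edge is its set of endpoints, a self-loop being a singleton. *)
Definition edge (V : finType) : finType := {e : {set V} | 0 < #|e| <= 2}.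

Lemma card_ends (V : finType) (u v : V) : 0 < #|[set u; v]| <= 2.
Proof. by rewrite cards2; case: (u != v). Qed.

Definition uedge (V : finType) (u v : V) : edge V :=
  Sub [set u; v] (card_ends u v).

Definition endpoints (V : finType) (e : edge V) : {set V} := val e.

Definition is_loop (V : finType) (e : edge V) : bool := #|endpoints e| == 1.

(* X e is the multiplicity of e in X. *)
Definition multigraph (V : finType) := {ffun edge V -> nat}.

Section Multigraph.
Variable V : finType.
Implicit Types (X : multigraph V) (v : V) (C : {set V}).

Definition degree X v : nat :=
  \sum_(e : edge V | v \in endpoints e) (if is_loop e then 2 else 1) * X e.

Definition even_degrees X : Prop := forall v, ~~ odd (degree X v).

Definition visits X v : nat := (degree X v)./2.

Definition nonempty X : Prop := exists e, 0 < X e.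

Definition adj X : rel V := fun u v => 0 < X (uedge u v).

(* A tour need not touch all of V, so connectedness only concerns the vertices
   incident to an edge; in particular the empty multigraph is connected. *)
Definition connected X : Prop :=
  forall u v, 0 < degree X u -> 0 < degree X v -> connect (adj X) u v.

Definition mvtsp_tour X : Prop := connected X /\ even_degrees X.

Definition edge_partition X k (T : 'I_k -> multigraph V) : Prop :=
  forall e, X e = \sum_(i < k) T i e.

(* Vertex sets of the components of (V, X). An isolated vertex would count as a
   component, but positive requests exclude isolated vertices. *)
Definition components X : {set {set V}} :=
  equivalence_partition (connect (adj X)) [set: V].

Definition restrict X C : multigraph V :=
  [ffun e => if endpoints e \subset C then X e else 0].

End Multigraph.

Local Open Scope ring_scope.

(* cost_of_loop is c(vv) <= 2 min_{u != v} c(uv), where the minimum over the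
   empty set is +oo, so it is vacuous when #|V| = 1. *)
Record instance (R : realFieldType) := Instance {
  vertex : finType;
  cost_of : edge vertex -> R;
  request : vertex -> nat;
  agents : nat;
  cost_of_ge0 : forall e, 0 <= cost_of e;
  cost_of_metric : forall u v w,
    cost_of (uedge u w) <= cost_of (uedge u v) + cost_of (uedge v w);
  cost_of_loop : forall u v, u != v ->
    cost_of (uedge v v) <= 2%:R * cost_of (uedge u v);
  request_gt0 : forall v, (0 < request v)%N;
  agents_gt0 : (0 < agents)%N
}.

Section Problems.
Variables (R : realFieldType) (I : instance R).
Local Notation V := (vertex I).
Local Notation m := (agents I).
Implicit Types (X : multigraph V).

Definition cost X : R := \sum_(e : edge V) (X e)%:R * cost_of e.

Definition meets_requests X : Prop :=
  even_degrees X /\ forall v, visits X v = request v.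

Definition mtsp_plus_arbitrary X : Prop :=
  meets_requests X /\
  exists T : 'I_m -> multigraph V,
    edge_partition X T /\ forall i, nonempty (T i) /\ mvtsp_tour (T i).

Definition mtsp_plus_disjoint X : Prop :=
  [/\ meets_requests X, #|components X| = m &
      forall C, C \in components X ->
        nonempty (restrict X C) /\ mvtsp_tour (restrict X C)].

Definition mtsp_0_arbitrary X : Prop :=
  meets_requests X /\
  exists k, (k <= m)%N /\
  exists T : 'I_k -> multigraph V,
    edge_partition X T /\ forall i, mvtsp_tour (T i).

Definition mtsp_0_disjoint X : Prop :=
  [/\ meets_requests X, (#|components X| <= m)%N &
      forall C, C \in components X -> mvtsp_tour (restrict X C)].

Definition optimal (P : multigraph V -> Prop) X : Prop :=
  P X /\ forall Y, P Y -> cost X <= cost Y.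

Definition is_OPT (P : multigraph V -> Prop) (z : R) : Prop :=
  exists X, optimal P X /\ cost X = z.

End Problems.

(* Main.v *)
Require Import Defs.
From HB Require Import structures.
From mathcomp Require Import all_boot all_order all_algebra.
From mathcomp Require Import zify.

(** Take two vertices, both with request 1, two agents, loops of cost 2 and a
    link of cost 1. The multigraphs meeting the requests are the two loops
    (cost 4) and the doubled link (cost 2). Only the former consists of two
    non-empty tours, while the latter is a single tour. *)

Set Implicit Arguments.
Unset Strict Implicit.
Unset Printing Implicit Defensive.

Import Order.TTheory GRing.Theory Num.Theory.

Lemma restrictT (V : finType) (X : multigraph V) : restrict X [set: V] = X.
Proof. by apply/ffunP => e; rewrite ffunE subsetT. Qed.

(** * Edges and multigraphs on two vertices *)

Definition loop (v : bool) : edge bool := uedge v v.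
Definition link : edge bool := uedge false true.

Lemma endpoints_loop v : endpoints (loop v) = [set v].
Proof. exact: setUid. Qed.

Lemma endpoints_link : endpoints link = [set: bool].
Proof. by apply/setP=> -[]; rewrite !inE. Qed.

Lemma is_loop_loop v : is_loop (loop v).
Proof. by rewrite /is_loop endpoints_loop cards1. Qed.

Lemma is_loop_link : is_loop link = false.
Proof. by rewrite /is_loop endpoints_link cardsT card_bool. Qed.

Lemma loop_inj : injective loop.
Proof. by move=> u v /(congr1 (@endpoints _)); rewrite !endpoints_loop => /set1_inj. Qed.

Lemma loop_neq_link v : (loop v == link) = false.
Proof. by apply/eqP => /(congr1 (@is_loop _)); rewrite is_loop_loop is_loop_link. Qed.

Lemma uedge_neq (u v : bool) : u != v -> uedge u v = link.
Proof. by case: u; case: v => // _; apply/val_inj; rewrite /= setUC. Qed.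

(** An edge is determined by which of the two vertices it contains, and non-emptiness rules out the
    fourth case. *)
Lemma edge_boolP (e : edge bool) : e \in [:: loop false; loop true; link].
Proof.
have eqe e' : endpoints e =i endpoints e' -> e = e' by move=> h; apply/val_inj/setP.
have := valP e; rewrite !inE => /andP[+ _]; rewrite card_gt0 => /set0Pn[u].
rewrite -/(endpoints e).
case t: (true \in endpoints e); case f: (false \in endpoints e) => ue.
- by rewrite (eqe link) ?eqxx ?orbT // endpoints_link => -[]; rewrite inE.
- by rewrite (eqe (loop true)) ?eqxx ?orbT // endpoints_loop => -[]; rewrite inE.
- by rewrite (eqe (loop false)) ?eqxx ?orbT // endpoints_loop => -[]; rewrite inE.
- by case: u ue; rewrite ?t ?f.
Qed.

(** Reduces degrees and costs to arithmetic in three multiplicities. *)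
Lemma big_edge_bool (T : Type) (idx : T) (op : Monoid.com_law idx)
    (P : pred (edge bool)) (F : edge bool -> T) :
  \big[op/idx]_(e | P e) F e =
  \big[op/idx]_(e <- [:: loop false; loop true; link] | P e) F e.
Proof.
rewrite big_mkcond [RHS]big_mkcond [RHS]big_uniq /=.
  by apply: eq_bigl => e; rewrite edge_boolP.
by rewrite !inE (inj_eq loop_inj) !loop_neq_link.
Qed.

Section Multigraph.
Implicit Types (X : multigraph bool) (v : bool).

Lemma degreeE X v : degree X v = 2 * X (loop v) + X link.
Proof.
rewrite /degree big_edge_bool !big_cons big_nil !is_loop_loop is_loop_link.
by rewrite !endpoints_loop endpoints_link !inE; case: v => /=; lia.
Qed.

(** Loops count twice, so only the link affects parity. *)
Lemma even_degreesP X : even_degrees X <-> ~~ odd (X link).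
Proof.
split=> [/(_ true)|h v]; rewrite degreeE oddD mul2n odd_double //.
Qed.

(** Without the link, two distinct vertices of positive degree would both carry loops, which the
    other two disjuncts exclude. *)
Lemma connected_bool X :
  [|| 0 < X link, X (loop false) == 0 | X (loop true) == 0] -> connected X.
Proof.
move=> h u v; rewrite !degreeE; have [->|uv] := eqVneq u v => [*|du dv].
  exact: connect0.
apply: connect1; rewrite /adj uedge_neq //.
by case: u v uv du dv => -[] // _; move: (X link) (X (loop false)) (X (loop true)) h; lia.
Qed.

Lemma nonempty_bool X :
  nonempty X -> [|| 0 < X link, 0 < X (loop false) | 0 < X (loop true)].
Proof.
by case=> e; have := edge_boolP e; rewrite !inE => /or3P[] /eqP-> ->; rewrite ?orbT.
Qed.

Lemma components_link X (C : {set bool}) :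
  0 < X link -> C \in components X -> C = [set: bool].
Proof.
move=> X0 /imsetP[u _ ->]; apply/setP => v; rewrite !inE /=.
have [->|uv] := eqVneq u v; first exact: connect0.
by apply: connect1; rewrite /adj uedge_neq.
Qed.

End Multigraph.

(** * The two competing multigraphs *)

Definition two_loops : multigraph bool := [ffun e => is_loop e : nat].
Definition double_link : multigraph bool := [ffun e => if is_loop e then 0 else 2].

Lemma two_loops_loop v : two_loops (loop v) = 1.
Proof. by rewrite ffunE is_loop_loop. Qed.

Lemma two_loops_link : two_loops link = 0.
Proof. by rewrite ffunE is_loop_link. Qed.

Lemma double_link_loop v : double_link (loop v) = 0.
Proof. by rewrite ffunE is_loop_loop. Qed.

Lemma double_link_link : double_link link = 2.
Proof. by rewrite ffunE is_loop_link. Qed.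

Lemma tour_double_link : mvtsp_tour double_link.
Proof.
split; first by apply: connected_bool; rewrite double_link_link.
by apply/even_degreesP; rewrite double_link_link.
Qed.

(** As the link is absent, [pred1 u] is closed under adjacency and traps every path from [u]. *)
Lemma connect_two_loops u v : connect (adj two_loops) u v = (u == v).
Proof.
apply/idP/eqP => [|->]; last exact: connect0.
move=> /(closed_connect (a := pred1 u)) h; apply/esym/eqP.
rewrite -[_ == _]/(v \in pred1 u) -h ?inE // => x y.
have [->//|xy] := eqVneq x y.
by rewrite /adj uedge_neq // two_loops_link.
Qed.

Lemma component_two_loops (C : {set bool}) :
  C \in components two_loops -> exists v, C = [set v].
Proof.
move=> /imsetP[v _ ->]; exists v; apply/setP => w.
by rewrite !inE /= connect_two_loops eq_sym.
Qed.

Lemma card_components_two_loops : #|components two_loops| = 2.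
Proof.
rewrite card_imset ?cardsT ?card_bool // => u v /setP/(_ u).
by rewrite !inE /= !connect_two_loops eqxx => /esym/eqP.
Qed.

Local Open Scope ring_scope.

(** * The instance and its optimal values *)

Section Gap.
Variable R : realFieldType.

(** With link cost 1, loop cost 2 is the largest that [cost_of_loop] permits. *)
Definition gap_cost (e : edge bool) : R := if is_loop e then 2 else 1.

Lemma gap_cost_ge0 e : 0 <= gap_cost e.
Proof. by rewrite /gap_cost; case: ifP. Qed.

Lemma gap_cost_uedge (u v : bool) : gap_cost (uedge u v) = (1 + (u == v))%:R.
Proof.
have [->|uv] := eqVneq u v; first by rewrite /gap_cost is_loop_loop.
by rewrite /gap_cost uedge_neq // is_loop_link.
Qed.

Lemma gap_cost_metric u v w :
  gap_cost (uedge u w) <= gap_cost (uedge u v) + gap_cost (uedge v w).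
Proof. by rewrite !gap_cost_uedge -natrD ler_nat; case: u v w => -[] -[]. Qed.

Lemma gap_cost_loop u v :
  u != v -> gap_cost (uedge v v) <= 2%:R * gap_cost (uedge u v).
Proof. by rewrite !gap_cost_uedge eqxx => /negPf->; rewrite mulr1. Qed.

Definition gap_instance : instance R :=
  @Instance R bool gap_cost (fun=> 1%N) 2 gap_cost_ge0 gap_cost_metric
    gap_cost_loop (fun=> isT) isT.

Implicit Types X : multigraph (vertex gap_instance).

(** One visit pins the degree to 2 or 3, and evenness leaves 2. *)
Lemma gap_meets_requestsP X :
  @meets_requests R gap_instance X <-> forall v, (2 * X (loop v) + X link = 2)%N.
Proof.
split=> [[ev vis] v|h].
  have := vis v; have := ev v; rewrite /visits -degreeE => d0 d1.
  by rewrite -[LHS]odd_double_half (negPf d0) d1.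
by split=> v; rewrite /visits degreeE h.
Qed.

(** Let a, b be the loop multiplicities and x that of the link. Adding both degree equations gives
    2a + 2b = 4 - 2x, so the cost 2a + 2b + x is 4 - x. Since x <= 2, the natural subtraction does
    not truncate. *)
Lemma gap_costE X : @meets_requests R gap_instance X ->
  @cost R gap_instance X = (4 - X link)%:R.
Proof.
move=> /gap_meets_requestsP h.
rewrite /cost big_edge_bool !big_cons big_nil /= /gap_cost !is_loop_loop is_loop_link.
rewrite mulr1 addr0 -!natrM -!natrD; congr (_%:R).
by move: (X link) (X (loop false)) (X (loop true)) (h true) (h false); lia.
Qed.

Lemma two_loops_meets_requests : @meets_requests R gap_instance two_loops.
Proof. by apply/gap_meets_requestsP => v; rewrite two_loops_loop two_loops_link. Qed.

Lemma double_link_meets_requests : @meets_requests R gap_instance double_link.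
Proof. by apply/gap_meets_requestsP => v; rewrite double_link_loop double_link_link. Qed.

(** Once the link is excluded, all feasible multigraphs cost 4; this serves both problems with
    exactly [m] tours. *)
Lemma is_OPT_two_loops (P : multigraph (vertex gap_instance) -> Prop) :
  P two_loops ->
  (forall X, P X -> @meets_requests R gap_instance X /\ X link = 0%N) ->
  @is_OPT R gap_instance P 4.
Proof.
move=> P2 PX; have c2 := gap_costE two_loops_meets_requests.
exists two_loops; rewrite /optimal c2 two_loops_link; do 2?split=> //.
by move=> X /PX[/gap_costE -> ->].
Qed.

(** The degree equation bounds the link multiplicity by 2, so no cost is below 4 - 2. *)
Lemma is_OPT_double_link (P : multigraph (vertex gap_instance) -> Prop) :
  P double_link -> (forall X, P X -> @meets_requests R gap_instance X) ->
  @is_OPT R gap_instance P 2.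
Proof.
move=> P2 PX; have c2 := gap_costE double_link_meets_requests.
exists double_link; rewrite /optimal c2 double_link_link; do 2?split=> //.
move=> X /PX mX; rewrite gap_costE // ler_nat.
by have /gap_meets_requestsP/(_ true) := mX; lia.
Qed.

(** * Feasibility in the four problems *)

Lemma plus_arbitrary_two_loops : @mtsp_plus_arbitrary R gap_instance two_loops.
Proof.
split; first exact: two_loops_meets_requests.
(* The boolean [i != ord0] is itself a vertex: the first agent takes the loop at [false], the second
   the loop at [true]. *)
exists (fun i => [ffun e => (e == loop (i != ord0)) : nat]); split=> [e|i].
  rewrite big_ord_recl big_ord1 !ffunE /=.
  have := edge_boolP e; rewrite !inE => /or3P[] /eqP->;
    by rewrite ?is_loop_loop ?is_loop_link ?(inj_eq loop_inj) // !(eq_sym link) !loop_neq_link.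
split; first by exists (loop (i != ord0)); rewrite ffunE eqxx.
split; last by apply/even_degreesP; rewrite ffunE eq_sym loop_neq_link.
by apply: connected_bool; rewrite !ffunE !(inj_eq loop_inj); case: (i != ord0); rewrite ?orbT.
Qed.

(* A tour using the link uses it twice, which exhausts the degrees and leaves
   nothing for the other tour. *)
Lemma plus_arbitrary_link X :
  @mtsp_plus_arbitrary R gap_instance X ->
  @meets_requests R gap_instance X /\ X link = 0%N.
Proof.
case=> mX [T [pT tT]]; split=> //.
have /gap_meets_requestsP h := mX.
have sum2 e : X e = (T ord0 e + T (lift ord0 ord0) e)%N.
  by rewrite pT big_ord_recl big_ord1.
have [/nonempty_bool n0 [_ /even_degreesP e0]] := tT ord0.
have [/nonempty_bool n1 [_ /even_degreesP e1]] := tT (lift ord0 ord0).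
move: (h true) (h false) n0 n1 e0 e1; rewrite !sum2.
move: (T ord0 link) (T ord0 (loop false)) (T ord0 (loop true)).
move: (T (lift ord0 ord0) link) (T (lift ord0 ord0) (loop false)).
by move: (T (lift ord0 ord0) (loop true)); lia.
Qed.

Lemma plus_disjoint_two_loops : @mtsp_plus_disjoint R gap_instance two_loops.
Proof.
split; [exact: two_loops_meets_requests | exact: card_components_two_loops |].
move=> C /component_two_loops[v ->].
split; first by exists (loop v); rewrite ffunE endpoints_loop subxx two_loops_loop.
split; last by apply/even_degreesP; rewrite ffunE two_loops_link if_same.
apply: connected_bool; rewrite !ffunE !endpoints_loop !sub1set !inE.
by case: v; rewrite ?orbT.
Qed.

(** A link would merge both vertices into one component, but two are required. *)
Lemma plus_disjoint_link X :
  @mtsp_plus_disjoint R gap_instance X ->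
  @meets_requests R gap_instance X /\ X link = 0%N.
Proof.
case=> mX c2 _; split=> //; apply/eqP; rewrite -leqn0 leqNgt; apply/negP => X0.
have : components X \subset [set [set: bool]].
  by apply/subsetP => C /(components_link X0)->; rewrite inE.
by move=> /subset_leq_card; rewrite c2 cards1.
Qed.

Lemma zero_arbitrary_double_link : @mtsp_0_arbitrary R gap_instance double_link.
Proof.
split; first exact: double_link_meets_requests.
(* A single tour takes everything; the other agent stays idle. *)
exists 1%N; split=> //; exists (fun=> double_link); split=> [e|_].
  by rewrite big_ord1.
exact: tour_double_link.
Qed.

Lemma zero_disjoint_double_link : @mtsp_0_disjoint R gap_instance double_link.
Proof.
split; first exact: double_link_meets_requests.
  (* There are at most as many components as vertices, which is already [m]. *)
  by apply: leq_trans (leq_imset_card _ _) _; rewrite cardsT card_bool.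
move=> C /components_link-> //; last by rewrite double_link_link.
by rewrite restrictT; exact: tour_double_link.
Qed.

End Gap.

Theorem claim2p7 (R : realFieldType) :
  (exists (I : instance R) (z1 z3 : R),
     is_OPT (@mtsp_plus_arbitrary R I) z1 /\ is_OPT (@mtsp_0_arbitrary R I) z3 /\ z1 <> z3) /\
  (exists (I : instance R) (z2 z4 : R),
     is_OPT (@mtsp_plus_disjoint R I) z2 /\ is_OPT (@mtsp_0_disjoint R I) z4 /\ z2 <> z4).
Proof.
have neq42 : 4 <> 2 :> R by move=> /eqP; rewrite eqr_nat.
(* The same instance and the same values settle both parts. *)
split; exists (gap_instance R), 4, 2; split; [|split=> //| |split=> //].
- apply: is_OPT_two_loops; first exact: plus_arbitrary_two_loops.
  exact: plus_arbitrary_link.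
- apply: is_OPT_double_link; first exact: zero_arbitrary_double_link.
  by move=> X [].
- apply: is_OPT_two_loops; first exact: plus_disjoint_two_loops.
  exact: plus_disjoint_link.
- apply: is_OPT_double_link; first exact: zero_disjoint_double_link.
  by move=> X [].
Qed.
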